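(* (Centered Mirror Descent Lemma) Let $\ell_1,\dots,\ell_T:\mathbb{R}^d\to\mathbb{R}$ be convex. Let $\psi_1,\dots,\psi_{T+1}:\mathbb{R}^d\to\mathbb{R}_{\ge0}$ be an arbitrary sequence of differentiable non-negative convex functions, and assume that $w_1\in\arg\min_{w\in\mathbb{R}^d}\psi_t(w)$ for all $t$. Let $\varphi_1,\dots,\varphi_T$ be an arbitrary sequence of sub-differentiable non-negative convex functions on $\mathbb{R}^d$. Let $w_2,\dots,w_{T+1}$ be given by $$w_{t+1}=\arg\min_{w\in\mathbb{R}^d}\ \ell_t(w)+D_{\psi_t}(w|w_t)+\phi_t(w),$$ where $\Delta_t(w)=D_{\psi_{t+1}}(w|w_1)-D_{\psi_t}(w|w_1)$ and $\phi_t(w)=\Delta_t(w)+\varphi_t(w)$. Then for any $u_1,\dots,u_T\in\mathbb{R}^d$ and any $g_t\in\partial\ell_t(w_t)$, $$\sum_{t=1}^T\big(\ell_t(w_t)-\ell_t(u_t)\big)\le\psi_{T+1}(u_T)+\sum_{t=1}^T\varphi_t(u_t)+\sum_{t=1}^{T-1}\langle\nabla\psi_{t+1}(w_{t+1}),u_t-u_{t+1}\rangle+\sum_{t=1}^T\Big(\langle g_t,w_t-w_{t+1}\rangle-D_{\psi_t}(w_{t+1}|w_t)-\phi_t(w_{t+1})\Big).$$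
   Context: For differentiable $\psi$, $D_\psi(x|y)=\psi(x)-\psi(y)-\langle\nabla\psi(y),x-y\rangle$. The minimizers $w_{t+1}$ are assumed to exist. The functions $\psi_{t+1},\varphi_t$ may depend on everything observed up to round $t$. *)

(* Defs.v *)
From HB Require Import structures.
From mathcomp Require Import all_boot all_order all_algebra.
From mathcomp Require Import all_classical all_reals.
From mathcomp Require Import topology normedtype derive convex.

Set Implicit Arguments.
Unset Strict Implicit.
Unset Printing Implicit Defensive.

Import Order.TTheory GRing.Theory Num.Theory.
Import numFieldNormedType.Exports.

Local Open Scope classical_set_scope.
Local Open Scope ring_scope.

Definition inner (R : realType) (d : nat) (x y : 'rV[R]_d) : R :=
  \sum_(i < d) x 0 i * y 0 i.

(* The vector of partial derivatives; it represents 'd f x through inner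
   wherever f is differentiable. *)
Definition gradient (R : realType) (d : nat) (f : 'rV[R]_d -> R)
    (x : 'rV[R]_d) : 'rV[R]_d :=
  \row_(i < d) 'D_(delta_mx 0 i) f x.

Definition bregman (R : realType) (d : nat) (psi : 'rV[R]_d -> R)
    (x y : 'rV[R]_d) : R :=
  psi x - psi y - inner (gradient psi y) (x - y).

Definition convex (R : realType) (d : nat) (f : 'rV[R]_d -> R) : Prop :=
  convex_function (setT : set (convex_lmodType 'rV[R]_d)) f.

Definition argmin (R : realType) (d : nat) (f : 'rV[R]_d -> R) :
    set 'rV[R]_d :=
  [set x | forall y, f x <= f y].

Definition subdifferential (R : realType) (d : nat) (f : 'rV[R]_d -> R)
    (x : 'rV[R]_d) : set 'rV[R]_d :=
  [set g | forall y, f x + inner g (y - x) <= f y].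

Definition subdifferentiable (R : realType) (d : nat) (f : 'rV[R]_d -> R) :
    Prop :=
  forall x, subdifferential f x !=set0.

Definition Delta (R : realType) (d : nat) (psi : nat -> 'rV[R]_d -> R)
    (w1 : 'rV[R]_d) (t : nat) (x : 'rV[R]_d) : R :=
  bregman (psi t.+1) x w1 - bregman (psi t) x w1.

Definition phi (R : realType) (d : nat) (psi varphi : nat -> 'rV[R]_d -> R)
    (w1 : 'rV[R]_d) (t : nat) (x : 'rV[R]_d) : R :=
  Delta psi w1 t x + varphi t x.

(* Main.v *)
(** Since w_1 minimizes every psi_t, grad psi_t(w_1) = 0, so up to a constant
    the t-th objective is l_t + varphi_t - <grad psi_t(w_t), .> + psi_{t+1},
    the sum of a convex function and a differentiable one.  First-order
    optimality of w_{t+1} together with the subgradient inequality at w_t bounds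
    the t-th regret by the t-th terms on the right plus an increment of
    <grad psi_t(w_t), u_t - w_t> + psi_t(w_t) - psi_t(w_1).
    These increments telescope, starting from 0; the final value is at most
    psi_{T+1}(u_T) + <grad psi_{T+1}(w_{T+1}), u_{T+1} - u_T> by convexity and
    nonnegativity of psi_{T+1}. *)
Require Import Defs.
From HB Require Import structures.
From mathcomp Require Import all_boot all_order all_algebra.
From mathcomp Require Import all_classical all_reals.
From mathcomp Require Import topology normedtype derive convex.
From mathcomp Require Import interval_inference lra.
Import Order.TTheory GRing.Theory Num.Theory.
Import numFieldNormedType.Exports.
Local Open Scope classical_set_scope.
Local Open Scope ring_scope.

Section Inner.
Set Implicit Arguments.
Context {R : realType} {d : nat}.
Implicit Types (x y z : 'rV[R]_d) (s : R).

Lemma innerDr x y z : inner x (y + z) = inner x y + inner x z.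
Proof.
by rewrite /inner -big_split; apply: eq_bigr => i _; rewrite mxE mulrDr.
Qed.

Lemma innerZr s x y : inner x (s *: y) = s * inner x y.
Proof.
by rewrite /inner mulr_sumr; apply: eq_bigr => i _; rewrite mxE mulrCA.
Qed.

Lemma innerBr x y z : inner x (y - z) = inner x y - inner x z.
Proof. by rewrite -scaleN1r innerDr innerZr mulN1r. Qed.

Lemma innerNl x y : inner (- x) y = - inner x y.
Proof. by rewrite /inner -sumrN; apply: eq_bigr => i _; rewrite mxE mulNr. Qed.

Lemma inner0l x : inner 0 x = 0.
Proof. by rewrite /inner big1// => i _; rewrite mxE mul0r. Qed.

End Inner.

Section Convexity.
Set Implicit Arguments.
Context {R : realType} {d : nat}.
Implicit Types (f h psi : 'rV[R]_d -> R) (x y v : 'rV[R]_d) (s c : R).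

Lemma deriveE_gradient f x v :
  differentiable f x -> 'D_v f x = inner (gradient f x) v.
Proof.
move=> df; rewrite deriveE// [in LHS](row_sum_delta v) linear_sum.
by apply: eq_bigr => i _; rewrite linearZ/= mxE deriveE// mulrC.
Qed.

(** Convexity controls increments only for [s] in (0, 1]. This is enough, because the two-sided
    derivative is also the limit of the difference quotients as [s] tends to 0 from the right. *)
Lemma derive_ge f x v c : derivable f x v ->
  (forall s, 0 < s <= 1 -> s * c <= f (s *: v + x) - f x) -> c <= 'D_v f x.
Proof.
move=> df le_f.
have df_right : (fun s => s^-1 *: (f (s *: v + x) - f x)) @ 0^'+ --> 'D_v f x.
  apply: cvg_trans df; apply: cvg_app.
  by apply: within_subset => s s0; rewrite gt_eqF.
rewrite -(cvg_lim _ df_right)//; apply: limr_ge.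
  by apply/cvg_ex; exists ('D_v f x).
near=> s; have s0 : 0 < s by [].
rewrite /GRing.scale/= ler_pdivlMl//; apply: le_f; rewrite s0/=.
by near: s; apply: nbhs_right_le.
Unshelve. all: by end_near. Qed.

Lemma derive_le f x v c : derivable f x v ->
  (forall s, 0 < s <= 1 -> f (s *: v + x) - f x <= s * c) -> 'D_v f x <= c.
Proof.
move=> df le_f; rewrite -lerN2 -deriveN//.
apply: derive_ge => [|s s01]; first exact: derivableN.
by rewrite mulrN -opprD lerN2 le_f.
Qed.

Lemma convex_segment f x y s : convex f -> 0 <= s <= 1 ->
  f (s *: (y - x) + x) - f x <= s * (f y - f x).
Proof.
move=> cvx_f /andP[s0 s1].
have := cvx_f (Itv01 s0 s1) y x (mem_set I) (mem_set I).
rewrite convRE /conv/= /unstable.onem => le_f.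
have -> : s *: (y - x) + x = s *: y + (1 - s) *: x.
  by rewrite scalerBr scalerBl scale1r addrAC addrA.
rewrite lerBlDr; apply: le_trans le_f _; lra.
Qed.

Lemma convexD f h : convex f -> convex h -> convex (fun x => f x + h x).
Proof.
move=> cvx_f cvx_h t x y xT yT.
apply: le_trans (lerD (cvx_f t x y xT yT) (cvx_h t x y xT yT)) _.
by rewrite !convRE/=; lra.
Qed.

Lemma convex_inner x : convex (inner x).
Proof. by move=> t y z _ _; rewrite convRE innerDr !innerZr. Qed.

Lemma gradient_le f x y : convex f -> differentiable f x ->
  inner (gradient f x) (y - x) <= f y - f x.
Proof.
move=> cvx_f df; rewrite -deriveE_gradient//.
apply: derive_le => [|s /andP[s0 s1]]; first exact: diff_derivable.
by apply: convex_segment => //; rewrite ltW.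
Qed.

(** On the segment from [x] to [y], minimality makes the increment of [psi] at least minus that of
    [h], hence at least [s * (h x - h y)] by convexity. Only [psi] is differentiated, so [h] may be
    nonsmooth. *)
Lemma argmin_convexD h psi x y : convex h -> differentiable psi x ->
  argmin (fun z => h z + psi z) x ->
  h x - h y <= inner (gradient psi x) (y - x).
Proof.
move=> cvx_h dpsi min_x; rewrite -deriveE_gradient//.
apply: derive_ge => [|s /andP[s0 s1]]; first exact: diff_derivable.
have s01 : 0 <= s <= 1 by rewrite ltW.
have := convex_segment x y s cvx_h s01.
by have := min_x (s *: (y - x) + x); lra.
Qed.

(** Directional derivatives at a minimizer are nonnegative; being linear in the direction, they
    vanish, as opposite directions show. *)
Lemma gradient_argmin f x : differentiable f x -> argmin f x ->
  gradient f x = 0.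
Proof.
move=> df min_x.
have D_ge0 v : 0 <= 'D_v f x.
  apply: derive_ge => [|s _]; first exact: diff_derivable.
  by rewrite mulr0 subr_ge0.
apply/rowP => i; rewrite !mxE; apply/eqP; rewrite eq_le D_ge0 andbT -oppr_ge0.
by have := D_ge0 (- delta_mx 0 i); rewrite !deriveE// linearN.
Qed.

End Convexity.

Theorem lemma1 (R : realType) (d T : nat) (hT : (1 <= T)%N)
  (l psi varphi : nat -> 'rV[R]_d -> R) (w : nat -> 'rV[R]_d)
  (l_convex : forall t, (1 <= t <= T)%N -> convex (l t))
  (psi_differentiable :
    forall t, (1 <= t <= T.+1)%N -> forall x, differentiable (psi t) x)
  (psi_ge0 : forall t, (1 <= t <= T.+1)%N -> forall x, 0 <= psi t x)
  (psi_convex : forall t, (1 <= t <= T.+1)%N -> convex (psi t))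
  (w1_argmin : forall t, (1 <= t <= T.+1)%N -> argmin (psi t) (w 1%N))
  (varphi_subdifferentiable :
    forall t, (1 <= t <= T)%N -> subdifferentiable (varphi t))
  (varphi_ge0 : forall t, (1 <= t <= T)%N -> forall x, 0 <= varphi t x)
  (varphi_convex : forall t, (1 <= t <= T)%N -> convex (varphi t))
  (w_argmin : forall t, (1 <= t <= T)%N ->
    argmin (fun x => l t x + bregman (psi t) x (w t)
                     + phi psi varphi (w 1%N) t x) (w t.+1))
  (u g : nat -> 'rV[R]_d)
  (g_subgradient :
    forall t, (1 <= t <= T)%N -> subdifferential (l t) (w t) (g t)) :
  \sum_(1 <= t < T.+1) (l t (w t) - l t (u t)) <=
    psi T.+1 (u T)
    + \sum_(1 <= t < T.+1) varphi t (u t)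
    + \sum_(1 <= t < T) inner (gradient (psi t.+1) (w t.+1)) (u t - u t.+1)
    + \sum_(1 <= t < T.+1)
        (inner (g t) (w t - w t.+1) - bregman (psi t) (w t.+1) (w t)
         - phi psi varphi (w 1%N) t (w t.+1)).
Proof.
pose G t := gradient (psi t) (w t).
have grad_w1 t : (1 <= t <= T.+1)%N -> gradient (psi t) (w 1%N) = 0.
  move=> tT.
  exact: gradient_argmin (psi_differentiable t tT _) (w1_argmin t tT).
have bregman_w1 t x : (1 <= t <= T.+1)%N ->
    bregman (psi t) x (w 1%N) = psi t x - psi t (w 1%N).
  by move=> tT; rewrite /bregman grad_w1// inner0l subr0.
(* Equal to [psi t (u t) - psi t (w 1) - bregman (psi t) (u t) (w t)]: the height at [u t] of the
   tangent to [psi t] at [w t], measured from the minimum of [psi t]. *)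
pose potential t :=
  inner (G t) (u t - w t) + psi t (w t) - psi t (w 1%N).
have potential1 : potential 1%N = 0.
  by rewrite /potential /G grad_w1// inner0l add0r subrr.
have round t : (1 <= t < T.+1)%N ->
    l t (w t) - l t (u t) <=
      varphi t (u t) + inner (G t.+1) (u t - u t.+1)
      + (inner (g t) (w t - w t.+1) - bregman (psi t) (w t.+1) (w t)
         - phi psi varphi (w 1%N) t (w t.+1))
      + (potential t.+1 - potential t).
  move=> tT; have tT1 : (1 <= t <= T.+1)%N by case/andP: tT => -> /ltnW.
  have tS : (1 <= t.+1 <= T.+1)%N by case/andP: tT.
  have cvx_h : convex (fun x => l t x + varphi t x + inner (- G t) x).
    apply: convexD (convex_inner _).
    by apply: convexD; [exact: l_convex|exact: varphi_convex].
  have := argmin_convexD (u t) cvx_h (psi_differentiable _ tS (w t.+1)).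
  (* The [psi t x] from the Bregman term cancels the one in [Delta], so this objective differs from
     the given one by a constant in [x]. *)
  have min_w : argmin (fun x => l t x + varphi t x + inner (- G t) x
                                + psi t.+1 x) (w t.+1).
    move=> x; have := w_argmin t tT x.
    rewrite /phi /Delta !bregman_w1// /bregman -/(G t) !innerBr !innerNl; lra.
  (* The subgradient inequality replaces [l t (w t.+1)] in the optimality bound by [l t (w t)], at
     the price of [inner (g t) (w t - w t.+1)]. *)
  move=> /(_ min_w); have := g_subgradient t tT (w t.+1).
  rewrite /potential /phi /Delta !bregman_w1// /bregman -/(G t) -/(G t.+1).
  by rewrite !innerBr !innerNl; lra.
have last_step := gradient_le (u T) (psi_convex T.+1 (leqnn _))
  (psi_differentiable T.+1 (leqnn _) (w T.+1)).
have := ler_sum_nat round.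
rewrite [leRHS]big_split/= telescope_sumr// potential1 subr0.
rewrite [X in _ <= X + _]big_split/= [X in _ <= X + _ + _]big_split/=.
(* The junk value [u T.+1] cancels between this last term and the potential. *)
rewrite [\sum_(1 <= t < T.+1) inner (G _) _]big_nat_recr//=.
(* Discards the [- psi T.+1 (w 1)] left over in the final potential. *)
have := psi_ge0 T.+1 (leqnn _) (w 1%N).
move: last_step; rewrite /potential -/(G T.+1) !(innerBr (G T.+1)).
rewrite /G; lra.
Qed.
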